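(* Let $(\mathcal X,d)$ be a compact metric space and let $T:\mathcal X\to\mathcal X$ be a continuous map. For every ergodic $T$-invariant Borel probability measure $\mu$ on $\mathcal X$, every $\epsilon>0$, and every $\delta\in(0,1)$, $$h^K_\mu(6\epsilon,\delta)\leq\underline h^{BK}_\mu(\epsilon),$$ where $h^K_\mu(6\epsilon,\delta)$ is the (upper) Katok covering entropy of $\mu$ at scale $6\epsilon$ and level $\delta$, and $\underline h^{BK}_\mu(\epsilon)$ is the lower Brin--Katok local entropy of $\mu$ at scale $\epsilon$.
   Context: For $n\geq 1$, the Bowen metric is $d_n(x,y)=\max_{0\leq j<n}d(T^jx,T^jy)$, and the $d_n$-ball of radius $r>0$ centred at $x\in\mathcal X$ is $B_n(x,r)=\{y\in\mathcal X: d_n(x,y)<r\}$. Let $\mu$ be an ergodic $T$-invariant Borel probability measure on $\mathcal X$ and $r>0$. The pointwise lower Brin--Katok local entropy at scale $r$ is $$\underline h^{BK}_\mu(x,r)=\liminf_{n\to\infty}-\frac1n\log\mu(B_n(x,r)).$$ Since $\mu$ is ergodic, $x\mapsto\underline h^{BK}_\mu(x,r)$ is $\mu$-almost everywhere constant; its a.e. constant value is denoted $\underline h^{BK}_\mu(r)$. For $\delta\in(0,1)$, $N^\delta_\mu(n,r)$ is the least number of $d_n$-balls of radius $r$ whose union has $\mu$-measure larger than $\delta$, and $$h^K_\mu(r,\delta)=\limsup_{n\to\infty}\frac1n\log N^\delta_\mu(n,r).$$ *)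

(* Defs.v *)
From HB Require Import structures.
From mathcomp Require Import all_boot all_order all_algebra.
From mathcomp Require Import all_classical all_reals all_analysis.

Set Implicit Arguments.
Unset Strict Implicit.
Unset Printing Implicit Defensive.

Import Order.TTheory GRing.Theory Num.Theory.
Import numFieldNormedType.Exports.

Local Open Scope classical_set_scope.
Local Open Scope ring_scope.

(* The point is what measurableType asks for; it only excludes the empty
   space, which carries no probability measure. *)
#[short(type="pmetricType")]
HB.structure Definition PointedMetric (K : numDomainType) :=
  {M of Pointed M & Metric K M}.

Notation borelType X := (g_sigma_algebraType (@open X)).

Section entropy.
Context {R : realType} {X : pmetricType R}.
Implicit Types (T : X -> X) (mu : probability (borelType X) R).
Implicit Types (n : nat) (x y : X) (r delta : R).

Definition invariant_measure T mu : Prop :=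
  forall A : set (borelType X), measurable A -> mu (T @^-1` A) = mu A.

Definition ergodic_measure T mu : Prop :=
  invariant_measure T mu /\
  forall A : set (borelType X), measurable A -> T @^-1` A = A ->
    mu A = 0%E \/ mu A = 1%E.

(* For n >= 1 this is the maximum over 0 <= j < n, as distances are >= 0; the
   junk value 0 at n = 0 does not affect the limits below. *)
Definition bowen_dist T n x y : R :=
  \big[Num.max/0]_(j < n) mdist (iter j T x) (iter j T y).

Definition bowen_ball T n x r : set X := [set y | bowen_dist T n x y < r].

Local Open Scope ereal_scope.

(* lne 0 = -oo, so a ball of measure 0 contributes +oo. *)
Definition lower_local_entropy T mu x r : \bar R :=
  limn_einf (fun n => - ((n%:R^-1)%:E * lne (mu (bowen_ball T n x r)))).

(* Local entropies are >= 0, so the default -oo cannot be mistaken for a value: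
   a lower bound by a nonnegative quantity entails that the constant exists. *)
Definition lower_brin_katok T mu r : \bar R :=
  xget -oo [set h | {ae mu, forall x, lower_local_entropy T mu x r = h}].

(* The infimum of a set of natural numbers, hence a minimum unless the set is
   empty, in which case it is +oo; the centres c i need not be distinct. *)
Definition katok_cover T mu delta n r : \bar R :=
  ereal_inf [set k%:R%:E | k in [set k : nat | exists c : 'I_k -> X,
    delta%:E < mu (\bigcup_i bowen_ball T n (c i) r)]].

Definition katok_entropy T mu r delta : \bar R :=
  limn_esup (fun n => (n%:R^-1)%:E * lne (katok_cover T mu delta n r)).

End entropy.

(* Main.v *)
Require Import Defs.
From mathcomp Require Import all_boot all_order all_algebra.
From mathcomp Require Import finmap ring lra.
From mathcomp Require Import all_classical all_reals all_analysis.
From mathcomp Require Import measurable_realfun ess_sup_inf.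

(** Write [f x] for the lower local entropy at scale [epsilon].

    Why the local entropy is a constant.  Since [T] maps
    [B_(n+1)(x, epsilon)] into [B_n(T x, epsilon)], invariance of [mu] gives
    [f (T x) <= f x] ([lower_local_entropy_subinvariant]).  A sublevel set [A]
    of such a function satisfies [A `<=` T^-1 A], so the sets [T^-n A] increase
    to a [T]-invariant set of the same measure as [A], which is therefore 0 or
    1 ([ergodic_subinvariant_set]); hence [f] is almost everywhere equal to
    some [h >= 0].

    Why it bounds the Katok entropy.  Fix [s > h].  Almost every [x] has
    arbitrarily large times [n] at which it is heavy, i.e.
    [mu (B_n(x, epsilon)) > exp (- n s)].  At most [exp (n s)] balls centred at
    heavy points can be pairwise disjoint, so the heavy points of time [n] fall
    into at most [exp (n s)] sets of [d_n]-diameter less than [4 epsilon]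
    ([heavy_small_cover]).  The time [n] depends on the point, though, while
    a cover in the metric [d_N] is wanted for every large [N].  So the orbit
    segment of length [N] is cut into blocks: at a point that is heavy for a
    time [n] in a fixed finite window, jump [n] steps ahead; at any other
    point, jump one step.  A block of the first kind has [exp (n s)] possible
    descriptions and one of the second kind a fixed number [K].  The points
    whose orbit makes at most [b] visits to the set of non-heavy points are
    then covered by at most [C (2 K)^b exp (N (s + gamma))] small sets.  This is
    proved by induction on [N] without enumerating the block patterns: if the
    window starts late enough, the weights
    [exp (n s) exp (- n (s + gamma)) = exp (- n gamma)]
    of the possible first heavy blocks sum to at most 1/2, and a first
    non-heavy step is paid for by the factor [2 K] ([small_cover_visits]).

    The non-heavy set has measure as small as desired once the window is long
    enough, and Markov's inequality then shows that the points making at most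
    [eta N] visits to it have measure larger than [delta]
    ([visits_markov]).  Altogether
    [(1/N) log N_mu^delta (N, 6 epsilon)] is at most
    [(log C)/N + eta log (2 K) + s + gamma], where [gamma] and [eta] are
    arbitrarily small and [K] depends only on [epsilon]. *)

Set Implicit Arguments.
Unset Strict Implicit.
Unset Printing Implicit Defensive.

Import Order.TTheory GRing.Theory Num.Theory.
Import numFieldNormedType.Exports.

Local Open Scope classical_set_scope.
Local Open Scope ring_scope.

(** * Bowen metrics *)

Section bowen.
Context {R : realType} {X : pmetricType R} (T : X -> X).
Implicit Types (n m k : nat) (x y z : X) (r s : R).

Lemma bowen_dist_ltP n x y r : 0 < r ->
  bowen_dist T n x y < r <->
  forall j, (j < n)%N -> mdist (iter j T x) (iter j T y) < r.
Proof.
move=> r0; split=> [/bigmax_ltP[_ dr] j jn|dr].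
  exact: (dr (Ordinal jn)).
by apply/bigmax_ltP; split=> // j _; exact: dr.
Qed.

Lemma bowen_dist_ge0 n x y : 0 <= bowen_dist T n x y.
Proof. exact: bigmax_ge_id. Qed.

Lemma bowen_distxx n x : bowen_dist T n x x = 0.
Proof.
apply/eqP; rewrite eq_le bowen_dist_ge0 andbT.
by apply: bigmax_le => // j _; rewrite mdistxx.
Qed.

Lemma bowen_dist_sym n x y : bowen_dist T n x y = bowen_dist T n y x.
Proof. by apply: eq_bigr => j _; rewrite metric_sym. Qed.

Lemma bowen_dist_triangle n x y z :
  bowen_dist T n x z <= bowen_dist T n x y + bowen_dist T n y z.
Proof.
apply: bigmax_le => [|j _]; first by rewrite addr_ge0// bowen_dist_ge0.
apply: (le_trans (metric_triangle _ (iter j T y) _)).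
by apply: lerD;
  apply: (le_bigmax _ (fun i : 'I_n => mdist (iter i T _) (iter i T _))).
Qed.

Lemma le_bowen_dist n m x y : (n <= m)%N ->
  bowen_dist T n x y <= bowen_dist T m x y.
Proof.
move=> nm.
exact: (@le_bigmax_ord _ _ _ _ _ xpredT
  (fun j => mdist (iter j T x) (iter j T y)) nm).
Qed.

Lemma bowen_dist_split n m x y r : 0 < r ->
  bowen_dist T n x y < r ->
  bowen_dist T m (iter n T x) (iter n T y) < r ->
  bowen_dist T (n + m) x y < r.
Proof.
move=> r0 /(bowen_dist_ltP _ _ _ r0) dn /(bowen_dist_ltP _ _ _ r0) dm.
apply/bowen_dist_ltP => // j jnm; have [/dn//|nj] := ltnP j n.
rewrite -(subnK nj) !iterD; apply: dm.
by rewrite ltn_subLR.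
Qed.

Lemma bowen_ballS n x r : 0 < r ->
  bowen_ball T n.+1 x r `<=` T @^-1` (bowen_ball T n (T x) r).
Proof.
move=> r0 y /(bowen_dist_ltP _ _ _ r0) d; apply/bowen_dist_ltP => // j jn.
by rewrite -!iterSr; exact: d.
Qed.

Lemma continuous_iter n : continuous T -> continuous (iter n T).
Proof.
move=> cT; elim: n => [|n ih] x; first exact: cvg_id.
exact: (continuous_comp (ih x) (cT (iter n T x))).
Qed.

Lemma near_bowen_dist n x r : continuous T -> 0 < r ->
  \forall y \near x, bowen_dist T n x y < r.
Proof.
move=> cT r0; near=> y.
apply/bowen_dist_ltP => // j jn; rewrite -[j]/(val (Ordinal jn)).
move: (Ordinal jn) => {jn}; near: y.
apply: filter_forall => j.
have /metricType_numDomainType.cvgrPdist_lt := @continuous_iter j cT x.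
exact.
Unshelve. all: by end_near. Qed.

Lemma open_bowen_ball n x r : continuous T -> open (bowen_ball T n x r).
Proof.
move=> cT; rewrite openE => y /= xyr.
have : 0 < r - bowen_dist T n x y by rewrite subr_gt0.
move=> /(near_bowen_dist n y cT); apply: filterS => z /=.
rewrite ltrBrDl; apply: le_lt_trans; exact: bowen_dist_triangle.
Qed.

End bowen.

(** * Covers by sets of small Bowen diameter *)

Section small_cover.
Context {R : realType} {X : pmetricType R} (T : X -> X).
Implicit Types (n m k N b : nat) (x y z : X) (r s w v : R) (E F : set X).

(** Covers are counted by sets of small [d_n]-diameter rather than by balls:
    such a family needs no choice of centres, so families for two successive
    orbit segments combine by intersection, as in [small_cover_iter].  The
    number of sets is bounded by a real [w] because the bounds are
    exponentials. *)
Definition small_cover r n E w : Prop :=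
  exists (I : finType) (c : I -> set X), [/\ #|I|%:R <= w,
    E `<=` \bigcup_i c i &
    forall i x y, c i x -> c i y -> bowen_dist T n x y < r].

Lemma small_cover_ge0 r n E w : small_cover r n E w -> 0 <= w.
Proof. by case=> I [c [Iw _ _]]; exact: le_trans Iw. Qed.

Lemma small_coverS r n m E F w v : E `<=` F -> (m <= n)%N -> w <= v ->
  small_cover r n F w -> small_cover r m E v.
Proof.
move=> EF mn wv [I [c [Iw Fc cr]]]; exists I, c; split.
- exact: le_trans wv.
- exact: subset_trans Fc.
- by move=> i x y cx cy; apply: le_lt_trans (cr i x y cx cy); exact: le_bowen_dist.
Qed.

Lemma small_cover0 r n : small_cover r n set0 0.
Proof. by exists void, (fun=> set0); split => //; rewrite card_void. Qed.

Lemma small_coverU r n E F w v : small_cover r n E w -> small_cover r n F v ->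
  small_cover r n (E `|` F) (w + v).
Proof.
move=> [I [c [Iw Ec cr]]] [J [d [Jv Fd dr]]].
exists (I + J)%type, (fun u => match u with inl i => c i | inr j => d j end).
split.
- by rewrite card_sum natrD lerD.
- move=> x [/Ec[i _ ci]|/Fd[j _ dj]]; first by exists (inl i).
  by exists (inr j).
- by case.
Qed.

Lemma small_cover_bigcup r n (E : nat -> set X) (w : nat -> R) k :
  (forall j, (j < k)%N -> small_cover r n (E j) (w j)) ->
  small_cover r n (\bigcup_(j < k) E j) (\sum_(j < k) w j).
Proof.
elim: k => [_|k ih Ew].
  by rewrite bigcup_mkord !big_ord0; exact: small_cover0.
rewrite bigcup_mkord !big_ord_recr/= -bigcup_mkord.
apply: small_coverU; last exact: Ew.
by apply: ih => j jk; apply: Ew; rewrite ltnW.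
Qed.

(** An orbit segment of length [n + m] is described by its first [n] points
    and its last [m] points, so the numbers of pieces multiply. *)
Lemma small_cover_iter r n m E F w v : 0 < r ->
  small_cover r n E w -> small_cover r m F v ->
  small_cover r (n + m) (E `&` iter n T @^-1` F) (w * v).
Proof.
move=> r0 [I [c [Iw Ec cr]]] [J [d [Jv Fd dr]]].
exists (I * J)%type, (fun u => c u.1 `&` iter n T @^-1` d u.2); split.
- by rewrite card_prod natrM ler_pM.
- move=> x [/Ec[i _ ci] /Fd[j _ dj]].
  by exists (i, j).
- move=> [i j] x y /= [cx dx] [cy dy].
  by apply: bowen_dist_split => //; [exact: (cr i)|exact: (dr j)].
Qed.

Lemma compact_small_cover r n : compact [set: X] -> continuous T -> 0 < r ->
  exists w, small_cover r n [set: X] w.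
Proof.
move=> cX cT r0; pose B x := bowen_ball T n x (r / 2).
have r20 : 0 < r / 2 by rewrite divr_gt0.
move: cX; rewrite compact_cover => /(_ X [set: X] B)[x _|x _|D _ XD].
- exact: open_bowen_ball.
- by exists x => //; rewrite /B /bowen_ball/= bowen_distxx.
exists #|{: D}|%:R, D, (fun u => B (val u)); split=> // [x _|u x y ux uy].
  by have [z zD zx] := XD x I; exists [` zD]%fset.
rewrite (splitr r); apply: le_lt_trans (bowen_dist_triangle _ _ _ (val u) _) _.
by apply: ltrD; rewrite // bowen_dist_sym.
Qed.

Definition visits (A : set X) N x : nat := (\sum_(i < N) (iter i T x \in A))%N.

Lemma visitsS A N x : visits A N.+1 x = ((x \in A) + visits A N (T x))%N.
Proof.
rewrite /visits big_ord_recl; congr (_ + _)%N.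
by apply: eq_bigr => i _; rewrite /= -iterSr.
Qed.

Lemma visits_iter A n m x : (visits A m (iter n T x) <= visits A (n + m) x)%N.
Proof.
rewrite /visits [X in (_ <= X)%N]big_split_ord/=.
apply: leq_trans (leq_addl _ _); apply: leq_sum => i _.
by rewrite addnC iterD.
Qed.

(** The counting estimate.  An orbit segment of length [N > M] starts either
    outside all the [A j], and then one step costs a factor [K] and one of the
    [b] allowed visits; or in some [A j], and then [l j] steps cost a factor
    [w j].  Relative to the growth [expR (N * t)], the second possibility
    accounts for [w j * expR (- (l j * t))], which sums to at most one half;
    the first is absorbed by the factor [2 * K] that one visit contributes to
    the bound.  Segments of length at most [M] are covered at once by the
    [C] pieces of the whole space. *)
Lemma small_cover_visits (r t K C : R) (M L : nat) (A : nat -> set X)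
    (l : nat -> nat) (w : nat -> R) :
  0 < r -> 0 <= t -> 1 <= K ->
  (forall j, (j < L)%N -> (0 < l j <= M)%N) ->
  (forall j, (j < L)%N -> small_cover r (l j) (A j) (w j)) ->
  \sum_(j < L) w j * expR (- ((l j)%:R * t)) <= 2^-1 ->
  small_cover r 1 [set: X] K -> small_cover r M [set: X] C ->
  forall N b, small_cover r N
    [set x | (visits (~` \bigcup_(j < L) A j) N x <= b)%N]
    (C * (2 * K) ^+ b * expR (N%:R * t)).
Proof.
move=> r0 t0 K1 lM lA lw KX CX; set G := ~` _.
have K0 : 0 <= K by exact: le_trans K1.
have C0 := small_cover_ge0 CX.
elim/ltn_ind => N IH b; have [NM|MN] := leqP N M.
  apply: small_coverS CX => //.
  rewrite -mulrA ler_peMr// -[leLHS]mulr1 ler_pM//.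
    by rewrite exprn_ege1// (le_trans K1)// ler_peMl// ler1n.
  by rewrite -expR0 ler_expR mulr_ge0.
case: N IH MN => // N IH MN.
pose V n c := [set x | (visits G n x <= c)%N].
pose W n c := C * (2 * K) ^+ c * expR (n%:R * t).
have W0 n c : 0 <= W n c.
  by rewrite /W !mulr_ge0 ?expR_ge0// exprn_ge0// mulr_ge0.
(* The first point is in none of the A j: with no visit allowed, this case is
   void. *)
have bad : small_cover r N.+1 ([set x | G x] `&` V N.+1 b) (2^-1 * W N.+1 b).
  case: b => [|b].
    apply: (small_coverS _ _ _ (small_cover0 r N.+1)) => //.
      by move=> x [Gx]; rewrite /V/= visitsS mem_set// ltn0.
    by rewrite mulr_ge0// invr_ge0.
  apply: small_coverS (small_cover_iter r0 KX (IH N _ b)) => //.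
    by move=> x [Gx]; rewrite /V/= visitsS mem_set.
  rewrite /W exprS.
  rewrite (_ : 2^-1 * _ = K * (C * (2 * K) ^+ b * expR (N.+1%:R * t))); last first.
    by field.
  rewrite ler_wpM2l// ler_wpM2l//.
    by rewrite mulr_ge0// exprn_ge0// mulr_ge0.
  by rewrite ler_expR ler_wpM2r// ler_nat.
(* The first point is in some A j, and l j steps are done at once. *)
have good : small_cover r N.+1
    (\bigcup_(j < L) (A j `&` iter (l j) T @^-1` V (N.+1 - l j)%N b))
    (2^-1 * W N.+1 b).
  have Wsum : \sum_(j < L) w j * W (N.+1 - l j)%N b <= 2^-1 * W N.+1 b.
    rewrite (le_trans _ (ler_wpM2r (W0 N.+1 b) lw))// mulr_suml.
    apply: ler_sum => j _; have /andP[lj0 ljM] := lM _ (ltn_ord j).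
    have ljN : (l j <= N.+1)%N by rewrite (leq_trans ljM)// ltnW.
    rewrite /W natrB// mulrBl expRD.
    set e := expR (- _); set f := expR _.
    by rewrite (_ : _ * (_ * (f * e)) = w j * e * (C * (2 * K) ^+ b * f)) //; ring.
  apply: (small_coverS (@subset_refl _ _) (leqnn _) Wsum).
  apply: small_cover_bigcup (fun j => w j * W (N.+1 - l j)%N b) _ _.
  move=> j jL; have /andP[lj0 ljM] := lM _ jL.
  have ljN : (l j <= N.+1)%N by rewrite (leq_trans ljM)// ltnW.
  rewrite -{1}(subnKC ljN); apply: small_cover_iter => //; first exact: lA.
  by apply: IH; rewrite ltn_subrL lj0.
apply: small_coverS (small_coverU bad good) => //; last first.
  by rewrite -mulrDl -div1r -splitr mul1r.
move=> x /= Vx; have [Gx|/contrapT[j /= jL Ajx]] := pselect (G x).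
  by left.
right; exists j => //; split => //=.
have /andP[lj0 ljM] := lM _ jL.
have ljN : (l j <= N.+1)%N by rewrite (leq_trans ljM)// ltnW.
by apply: leq_trans Vx; rewrite -{2}(subnKC ljN) visits_iter.
Qed.

End small_cover.

(** * Points whose Bowen ball has large measure *)

Section heavy.
Context {R : realType} {X : pmetricType R} (T : X -> X).
Context (mu : probability (borelType X) R).
Context (contT : continuous T).
Implicit Types (n m k N b : nat) (x y z : X) (r s w v : R).

Lemma open_borel (A : set X) : open A -> measurable (A : set (borelType X)).
Proof. exact: sub_sigma_algebra. Qed.

Lemma measurable_bowen_ball n x r :
  measurable (bowen_ball T n x r : set (borelType X)).
Proof. by apply: open_borel; exact: open_bowen_ball. Qed.

(** The points [x] with [- (1/n) log (mu (B_n(x, r))) < s], written without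
    division or logarithm. *)
Definition heavy n r s : set X :=
  [set x | ((expR (- (n%:R * s)))%:E < mu (bowen_ball T n x r))%E].

(** The measure of [B_n(x, r)] is lower semicontinuous in [x]: the concentric
    balls of radius [r - 1/(k+1)] exhaust [B_n(x, r)], so one of them already
    has measure above the threshold, and it is contained in [B_n(z, r)] as soon
    as [d_n(x, z) < 1/(k+1)]. *)
Lemma open_heavy n r s : open (heavy n r s).
Proof.
rewrite openE => x /= hx.
pose B k := bowen_ball T n x (r - k.+1%:R^-1) : set (borelType X).
have mB k : measurable (B k) by exact: measurable_bowen_ball.
have BE : \bigcup_k B k = bowen_ball T n x r.
  apply/seteqP; split=> y.
    by move=> [k _]; rewrite /B/bowen_ball/= => /lt_trans; apply; rewrite gtrBl.
  rewrite /bowen_ball /= -subr_gt0 => /ltr_add_invr[k].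
  by rewrite add0r ltrBrDl -ltrBrDr => yk; exists k.
have ndB : nondecreasing_seq B.
  move=> i j ij; apply/subsetPset => y; rewrite /B/bowen_ball/= => /lt_le_trans; apply.
  by rewrite lerB// lef_pV2 ?posrE// ler_nat ltnS.
have /cvg_lim muB : (mu \o B) @ \oo --> mu (\bigcup_k B k).
  apply: nondecreasing_cvg_mu => //; exact: bigcup_measurable.
have [k hk] : exists k, ((expR (- (n%:R * s)))%:E < mu (B k))%E.
  apply/not_existsP => nk; move: hx; rewrite /heavy/= ltNge => /negP; apply.
  rewrite -BE -muB//; apply: lime_le; first by
    apply: ereal_nondecreasing_is_cvgn => i j ij; apply: le_measure;
    rewrite ?inE//; apply/subsetPset; exact: ndB.
  by apply: nearW => k; rewrite leNgt; apply/negP/nk.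
have k0 : 0 < k.+1%:R^-1 :> R by rewrite invr_gt0.
apply: filterS (near_bowen_dist n x contT k0) => z xz.
rewrite /heavy/=; apply: (lt_le_trans hk); apply: le_measure; rewrite ?inE//.
  exact: measurable_bowen_ball.
move=> y; rewrite /B/bowen_ball/= => xy.
apply: le_lt_trans (bowen_dist_triangle T n z x y) _.
by rewrite bowen_dist_sym addrC -[ltRHS](subrK k.+1%:R^-1) ltrD.
Qed.

(** Each of the disjoint balls has measure at least [expR (- (n * s))], and the
    total measure is at most 1. *)
Lemma disjoint_heavy_size n r s (t : seq X) :
  (forall x, x \in t -> heavy n r s x) ->
  pairwise (fun x y => `[< bowen_ball T n x r `&` bowen_ball T n y r = set0 >]) t ->
  (size t)%:R <= expR (n%:R * s).
Proof.
move=> ht dt.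
pose U (u : seq X) : set (borelType X) :=
  \big[setU/set0]_(x <- u) bowen_ball T n x r.
suff H : (((size t)%:R * expR (- (n%:R * s)))%:E <= mu (U t))%E.
  have mt : measurable (U t).
    by apply: bigsetU_measurable => x _; exact: measurable_bowen_ball.
  have := le_trans H (probability_le1 mu mt).
  by rewrite lee_fin expRN ler_pdivrMr ?expR_gt0// mul1r.
elim: t ht dt => [|x t ih] ht /=; first by rewrite /U big_nil mul0r measure0.
move=> /andP[/allP xt /ih{}ih].
rewrite /U big_cons measureU//=.
- rewrite -natr1 mulrDl mul1r addrC EFinD leeD//.
    by apply/ltW/ht; rewrite mem_head.
  by apply: ih => y yt; apply: ht; rewrite in_cons yt orbT.
- exact: measurable_bowen_ball.
- by apply: bigsetU_measurable => y _; exact: measurable_bowen_ball.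
- rewrite -subset0 => y [yx].
  rewrite -bigcup_seq => -[z /= zt yz].
  have /asboolP/seteqP[xz _] := xt _ zt; exact: (xz y).
Qed.

(** Take a family of heavy points with pairwise disjoint balls, of maximal
    size.  By maximality the ball of any heavy point meets one of these balls,
    so heavy points are within [2 * r] of the family. *)
Lemma heavy_small_cover n r s : 0 < r ->
  small_cover T (4 * r) n (heavy n r s) (expR (n%:R * s)).
Proof.
move=> r0.
pose P k := `[< exists t : seq X, [/\ size t = k,
  forall x, x \in t -> heavy n r s x &
  pairwise (fun x y => `[< bowen_ball T n x r `&` bowen_ball T n y r = set0 >]) t] >].
have exP : exists k, P k by exists 0%N; apply/asboolP; exists [::].
have Pb k : P k -> (k <= Num.bound (expR (n%:R * s)))%N.
  move=> /asboolP[t [<- ht dt]]; rewrite -(ler_nat R).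
  apply: le_trans (disjoint_heavy_size ht dt) _.
  by apply/ltW/archi_boundP/expR_ge0.
case: (ex_maxnP exP Pb) => k /asboolP[t [tk ht dt]] kmax.
exists 'I_(size t), (fun i =>
  [set x | bowen_dist T n (tnth (in_tuple t) i) x < 2 * r]).
split=> [|x hx|i x y /= ix iy].
- by rewrite card_ord; exact: disjoint_heavy_size ht dt.
- have [[y yt [z [zx zy]]]|far] := pselect (exists2 y, y \in t &
      bowen_ball T n x r `&` bowen_ball T n y r !=set0).
    have [i _ yi] : exists2 i, i \in predT & y = tnth (in_tuple t) i.
      by have /tnthP[i ->] : y \in in_tuple t by []; exists i.
    exists i => //=; rewrite -yi.
    apply: le_lt_trans (bowen_dist_triangle T n _ z _) _.
    rewrite mulr_natl mulr2n; apply: ltrD => //.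
    by rewrite bowen_dist_sym.
  have /kmax : P k.+1.
    apply/asboolP; exists (x :: t); split => /=; first by rewrite tk.
      by move=> y; rewrite in_cons => /predU1P[->|/ht].
    rewrite dt andbT; apply/allP => y yt; apply/asboolP.
    by apply: contrapT => /eqP/set0P xy; apply: far; exists y.
  by rewrite ltnn.
- apply: le_lt_trans (bowen_dist_triangle T n _ (tnth (in_tuple t) i) _) _.
  by rewrite bowen_dist_sym; lra.
Qed.

End heavy.

(** * Limits inferior and superior of extended real sequences *)

Section ereal_limits.
Context {R : realType}.
Implicit Types (u : (\bar R)^nat) (s : R).
Local Open Scope ereal_scope.

(** Comparing through the finite upper bounds of [x] makes every later
    estimate a statement about real thresholds, whatever infinite values the
    entropies may take. *)
Lemma lee_EFin_ub (x y : \bar R) :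
  (forall s : R, x < s%:E -> y <= s%:E) -> y <= x.
Proof.
case: x => [r| |] xy; last 1 first.
- case: y xy => [t| |]//.
    by move=> /(_ (t - 1)%R (ltNyr _)); rewrite lee_fin lerBrDr gerDl ler10.
  by move=> /(_ 0%R (ltNyr _)).
- apply/lee_addgt0Pr => e e0; rewrite -EFinD; apply: xy.
  by rewrite lte_fin ltrDl.
- exact: leey.
Qed.

Lemma limn_einf_sup_einfs u : limn_einf u = ereal_sup (range (einfs u)).
Proof. by rewrite limn_einf_lim; apply/cvg_lim => //; exact: cvg_einfs_sup. Qed.

Lemma limn_einf_lt u s N : limn_einf u < s%:E -> exists2 n, (N <= n)%N & u n < s%:E.
Proof.
rewrite limn_einf_sup_einfs => us.
have : einfs u N < s%:E.
  by apply: le_lt_trans us; apply: ereal_sup_ubound; exists N.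
by move=> /ereal_inf_lt[_ [n /= Nn <-] uns]; exists n.
Qed.

Lemma limn_einf_le u s :
  (forall N, exists2 n, (N <= n)%N & u n <= s%:E) -> limn_einf u <= s%:E.
Proof.
move=> us; rewrite limn_einf_sup_einfs; apply: ub_ereal_sup => _ [N _ <-].
have [n Nn uns] := us N; apply: le_trans uns.
by apply: ereal_inf_lbound; exists n.
Qed.

Lemma limn_esup_le u s N :
  (forall n, (N <= n)%N -> u n <= s%:E) -> limn_esup u <= s%:E.
Proof.
move=> us; rewrite limn_esup_lim (cvg_lim _ (@cvg_esups_inf _ u))//.
apply: (@le_trans _ _ (esups u N)); first by apply: ereal_inf_lbound; exists N.
by apply: ub_ereal_sup => _ [n /= Nn <-]; exact: us.
Qed.

End ereal_limits.

(** * Visits to a set *)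

Section visits.
Context {R : realType} {X : pmetricType R} (T : X -> X).
Context (mu : probability (borelType X) R).
Context (contT : continuous T) (invT : invariant_measure T mu).
Implicit Types (n m k N b : nat) (x y z : X) (r s w v : R).

Lemma measurable_preimage_continuous (A : set (borelType X)) :
  measurable A -> measurable (T @^-1` A : set (borelType X)).
Proof.
move=> mA.
have mT : measurable_fun [set: borelType X] (T : borelType X -> borelType X).
  apply: (@measurability _ _ (borelType X) (borelType X) _ _ (@open X)) => //.
  move=> _ [U oU <-]; rewrite setTI; apply: open_borel.
  by apply: open_comp => // x _; exact: contT.
by rewrite -[X in measurable X]setTI; exact: mT.
Qed.

Lemma measurable_preimage_iter n (A : set (borelType X)) :
  measurable A -> measurable (iter n T @^-1` A : set (borelType X)).
Proof.
elim: n A => [//|n ih] A mA.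
exact: (ih _ (measurable_preimage_continuous mA)).
Qed.

Lemma measure_preimage_iter n (A : set (borelType X)) :
  measurable A -> mu (iter n T @^-1` A) = mu A.
Proof.
elim: n A => [//|n ih] A mA.
rewrite -(invT mA) -(ih (T @^-1` A))//.
exact: measurable_preimage_continuous.
Qed.

Lemma visits_indic (A : set X) N x :
  (visits T A N x)%:R = \sum_(i < N) \1_(iter i T @^-1` A) x :> R.
Proof.
rewrite /visits natr_sum; apply: eq_bigr => i _; rewrite indicE.
by congr (nat_of_bool _)%:R; apply/idP/idP; rewrite !inE.
Qed.

Lemma measurable_visits (A : set (borelType X)) N b : measurable A ->
  measurable ([set x | (b < visits T A N x)%N] : set (borelType X)).
Proof.
move=> mA; rewrite (_ : [set x | _] =
  [set: borelType X] `&` [set x |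
    (b.+1%:R%:E <= \sum_(i < N) (\1_(iter i T @^-1` A) x)%:E :> \bar R)%E]).
  apply: emeasurable_fun_c_infty => //; apply: emeasurable_sum => i.
  by apply/measurable_EFinP; apply: measurable_indic; exact: measurable_preimage_iter.
rewrite setTI; apply/seteqP; split=> x /=;
  by rewrite sumEFin lee_fin -visits_indic ler_nat.
Qed.

(** Markov's inequality for the number of visits, whose integral is
    [N * mu A] by invariance. *)
Lemma visits_markov (A : set (borelType X)) N b : measurable A ->
  (b.+1%:R%:E * mu [set x | (b < visits T A N x)%N] <= N%:R%:E * mu A)%E.
Proof.
move=> mA.
pose g (x : borelType X) : \bar R := (\sum_(i < N) (\1_(iter i T @^-1` A) x)%:E)%E.
have gE x : g x = (visits T A N x)%:R%:E by rewrite visits_indic /g sumEFin.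
have mi (i : 'I_N) : measurable_fun [set: borelType X]
    (EFin \o (\1_(iter i T @^-1` A) : borelType X -> R)).
  by apply/measurable_EFinP; apply: measurable_indic; exact: measurable_preimage_iter.
have mg : measurable_fun [set: borelType X] g.
  by apply: emeasurable_sum => i; exact: mi.
have -> : [set x | (b < visits T A N x)%N] =
    [set: borelType X] `&` [set x | (b.+1%:R%:E <= `|g x|)%E].
  by rewrite setTI; apply/seteqP; split=> x /=; rewrite gE gee0_abs ?lee_fin// ler_nat.
have := @le_integral_comp_abse _ _ _ mu setT measurableT g b.+1%:R idfun.
move=> /(_ (@measurable_id _ _ _)) H.
apply: (le_trans (H _ _ mg _)) => //.
rewrite (eq_integral g) => [|x _]; last by rewrite /= gee0_abs// gE lee_fin.
rewrite /g ge0_integral_sum//.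
rewrite (eq_bigr (fun=> mu A)) => [|i _].
  by rewrite sumr_const card_ord mule_natl.
rewrite integral_indic// ?setIT; first exact: measure_preimage_iter.
exact: measurable_preimage_iter.
Qed.

End visits.

(** * The lower local entropy *)

Section local_entropy.
Context {R : realType} {X : pmetricType R} (T : X -> X).
Context (mu : probability (borelType X) R).
Context (contT : continuous T).
Implicit Types (n m k N b : nat) (x y z : X) (r s w v : R).

Lemma entropy_rate_lt n (v s : R) : (0 < n)%N ->
  (- ((n%:R^-1)%:E * lne v%:E) < s%:E)%E = (expR (- (n%:R * s)) < v).
Proof.
move=> n0; have n0R : 0 < n%:R :> R by rewrite ltr0n.
have [v0|v0] := leP v 0.
  rewrite le0_lneNy ?lee_fin// gt0_muleNy ?lte_fin ?invr_gt0//=.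
  by apply/esym/negbTE; rewrite -leNgt (le_trans v0)// expR_ge0.
rewrite lne_EFin// -EFinM -EFinN lte_fin -{2}(lnK v0) ltr_expR.
by rewrite ltrNl ltr_pdivlMl// mulrN.
Qed.

(** At [n = 0] the right-hand side would read [0 < s%:E], whatever the ball. *)
Lemma heavyE n r s x : (0 < n)%N ->
  heavy T mu n r s x <->
  (- ((n%:R^-1)%:E * lne (mu (bowen_ball T n x r))) < s%:E)%E.
Proof.
move=> n0; rewrite /heavy/=.
have /fineK <- : mu (bowen_ball T n x r) \is a fin_num.
  by apply: fin_num_measure; exact: measurable_bowen_ball.
by rewrite entropy_rate_lt// lte_fin.
Qed.

Lemma lower_local_entropy_heavy r s x N :
  (lower_local_entropy T mu x r < s%:E)%E ->
  exists2 n, (N < n)%N & heavy T mu n r s x.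
Proof.
move=> /(limn_einf_lt N.+1)[n Nn us]; exists n => //.
by apply/heavyE => //; apply: leq_trans Nn.
Qed.

Lemma heavy_lower_local_entropy r s x :
  (forall N, exists2 n, (N < n)%N & heavy T mu n r s x) ->
  (lower_local_entropy T mu x r <= s%:E)%E.
Proof.
move=> hs; apply: limn_einf_le => N; have [n Nn hn] := hs N.
exists n; first exact: ltnW.
by apply/ltW/heavyE => //; apply: leq_trans Nn.
Qed.

Lemma lower_local_entropy_ge0 r x : (0 <= lower_local_entropy T mu x r)%E.
Proof.
rewrite /lower_local_entropy limn_einf_sup_einfs.
apply: (@le_trans _ _ (einfs (fun n =>
  - ((n%:R^-1)%:E * lne (mu (bowen_ball T n x r))))%E 0%N)).
  apply: le_ereal_inf_tmp => _ [n _ <-].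
  rewrite oppe_ge0 mule_ge0_le0 ?lee_fin ?invr_ge0// lne_le0.
  by apply: probability_le1; exact: measurable_bowen_ball.
by apply: ereal_sup_ubound; exists 0%N.
Qed.

(** The sublevel set is described by the open sets of heavy points: [f x <= s]
    means that for every threshold above [s] the point [x] is heavy for
    infinitely many [n]. *)
Lemma measurable_lower_local_entropy_le r s :
  measurable ([set x | (lower_local_entropy T mu x r <= s%:E)%E] : set (borelType X)).
Proof.
rewrite [X in measurable X](_ : _ = \bigcap_k \bigcap_N
    \bigcup_(n in [set n | (N < n)%N]) heavy T mu n r (s + k.+1%:R^-1)).
  apply: bigcap_measurable => // k _; apply: bigcap_measurable => // N _.
  by apply: bigcup_measurable => n _; apply: open_borel; exact: open_heavy.
apply/seteqP; split=> x /= xs.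
  move=> k _ N _.
  have /(lower_local_entropy_heavy N)[n Nn hn] :
    (lower_local_entropy T mu x r < (s + k.+1%:R^-1)%:E)%E.
    by apply: le_lt_trans xs _; rewrite lte_fin ltrDl.
  by exists n.
apply: lee_EFin_ub => t; rewrite lte_fin -subr_gt0 => /ltr_add_invr[k].
rewrite add0r ltrBrDl => kt; apply: (@le_trans _ _ (s + k.+1%:R^-1)%:E).
  by apply: heavy_lower_local_entropy => N; have [n Nn hn] := xs k I N I; exists n.
by rewrite lee_fin ltW.
Qed.

(** If [x] is heavy at time [n + 1] for the threshold [s], then
    [mu (B_n(T x, r)) >= mu (B_(n+1)(x, r)) > exp (- (n + 1) s)].  The shift from
    [n + 1] to [n] is absorbed by passing to a threshold [t > s], as
    [(n + 1) s <= n t] for large [n]. *)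
Lemma lower_local_entropy_subinvariant r x : invariant_measure T mu -> 0 < r ->
  (lower_local_entropy T mu (T x) r <= lower_local_entropy T mu x r)%E.
Proof.
move=> invT r0; apply: lee_EFin_ub => s xs.
apply: lee_EFin_ub => t; rewrite lte_fin => st.
apply: heavy_lower_local_entropy => N.
(* (n + 1) * s <= n * t amounts to s / (t - s) <= n. *)
pose M := Num.bound `|s / (t - s)|.
have [[//|n] Nn hn] := lower_local_entropy_heavy (maxn N.+1 M) xs.
move: Nn; rewrite gtn_max => /andP[Nn Mn].
exists n => //; rewrite /heavy/=.
have /lt_le_trans : (mu (bowen_ball T n.+1 x r) <= mu (bowen_ball T n (T x) r))%E.
  have mB := measurable_bowen_ball contT n (T x) r.
  rewrite -(invT _ mB); apply: le_measure; rewrite ?inE.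
  - exact: measurable_bowen_ball.
  - exact: measurable_preimage_continuous.
  - exact: bowen_ballS.
apply; apply: le_lt_trans hn; rewrite lee_fin ler_expR lerN2 -natr1 mulrDl mul1r.
rewrite -lerBrDl -mulrBr -ler_pdivrMr ?subr_gt0//.
apply: le_trans (ler_norm _) _.
apply: le_trans (ltW (archi_boundP (normr_ge0 _))) _.
by rewrite ler_nat.
Qed.

End local_entropy.

(** * Almost sure constancy *)

Section ae_constant.
Context {R : realType} {X : pmetricType R} (T : X -> X).
Context (mu : probability (borelType X) R).
Context (contT : continuous T).

(** Ergodicity speaks of strictly invariant sets only; the increasing union of
    the preimages of [A] is one, and has the measure of [A] since all these
    preimages do. *)
Lemma ergodic_subinvariant_set (A : set (borelType X)) : ergodic_measure T mu ->
  measurable A -> A `<=` T @^-1` A -> mu A = 0%E \/ mu A = 1%E.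
Proof.
move=> [invT ergT] mA AT; pose F n : set (borelType X) := iter n T @^-1` A.
have mF n : measurable (F n) by exact: measurable_preimage_iter.
have ndF : nondecreasing_seq F.
  by apply/nondecreasing_seqP => n; apply/subsetPset => x; exact: AT.
have mUF : measurable (\bigcup_n F n) by exact: bigcup_measurable.
have <- : mu (\bigcup_n F n) = mu A.
  have /cvg_lim <- // := nondecreasing_cvg_mu (mu := mu) mF mUF ndF.
  rewrite (_ : mu \o F = cst (mu A)) ?lim_cst//.
  by apply/funext => n; rewrite /= measure_preimage_iter.
apply: ergT => //; apply/seteqP; split=> x [n _ Fx].
  by exists n.+1 => //; rewrite /F/preimage/= -iterS iterSr.
by exists n => //; move: (AT _ Fx); rewrite /F /preimage/= -iterS iterSr.
Qed.

(** Every sublevel set of [f] has measure 0 or 1, so no real number separates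
    the essential infimum from the essential supremum. *)
Lemma ergodic_subinvariant_cst (f : borelType X -> \bar R) :
  ergodic_measure T mu ->
  (forall s : R, measurable [set x | (f x <= s%:E)%E]) ->
  (forall x, (f (T x) <= f x)%E) ->
  {ae mu, forall x, f x = ess_inf mu f}.
Proof.
move=> ergT mf fT.
have ge_inf : {ae mu, forall x, (ess_inf mu f <= f x)%E} by exact: ess_inf_le.
have le_sup : {ae mu, forall x, (f x <= ess_sup mu f)%E} by exact: ess_sup_ge.
have sup_inf : (ess_sup mu f <= ess_inf mu f)%E.
  apply: lee_EFin_ub => s infs; apply/ess_supP.
  have sT : [set x | (f x <= s%:E)%E] `<=` T @^-1` [set x | (f x <= s%:E)%E].
    by move=> x /=; exact: le_trans (fT x).
  have [fs0|fs1] := ergodic_subinvariant_set ergT (mf s) sT.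
    have : (s%:E <= ess_inf mu f)%E.
      apply/ess_infP; exists [set x | (f x <= s%:E)%E]; split => // x /= /negP.
      by rewrite -ltNge => /ltW.
    by rewrite leNgt infs.
  exists (~` [set x | (f x <= s%:E)%E]); split => //; first exact: measurableC.
  have muC := probability_setC mu (mf s).
  by rewrite fs1 subee in muC.
apply: filterS2 ge_inf le_sup => x fge fle.
by apply/eqP; rewrite eq_le fge andbT (le_trans fle).
Qed.

Lemma lower_brin_katokP r : 0 < r -> ergodic_measure T mu ->
  {ae mu, forall x, lower_local_entropy T mu x r = lower_brin_katok T mu r}.
Proof.
move=> r0 ergT; rewrite /lower_brin_katok.
case: xgetP => [h _ //|/(_ (ess_inf mu (fun x => lower_local_entropy T mu x r)))].
case; apply: (ergodic_subinvariant_cst ergT) => [s|x].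
  exact: measurable_lower_local_entropy_le.
by apply: lower_local_entropy_subinvariant => //; case: ergT.
Qed.

End ae_constant.

(** * Bounding the Katok entropy *)

Lemma ae_bigcup_setC_small d (Y : measurableType d) (R : realType)
    (mu : probability Y R) (F : (set Y)^nat) (a : R) :
  (forall n, measurable (F n)) -> nondecreasing_seq F ->
  {ae mu, forall x, (\bigcup_n F n) x} -> 0 < a ->
  exists n, (mu (~` F n) < a%:E)%E.
Proof.
move=> mF ndF aeF a0.
have mUF : measurable (\bigcup_n F n) by exact: bigcup_measurable.
have muUF : mu (\bigcup_n F n) = 1%E.
  rewrite -[X in mu X]setCK probability_setC; last exact: measurableC.
  by rewrite (measure_negligible _ aeF) ?sube0//; exact: measurableC.
apply/not_existsP => nF.
have /cvg_lim muF : (mu \o F) @ \oo --> mu (\bigcup_n F n).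
  exact: nondecreasing_cvg_mu.
have : (mu (\bigcup_n F n) <= (1 - a)%:E)%E.
  rewrite -muF//; apply: lime_le.
    apply: ereal_nondecreasing_is_cvgn => i j ij; apply: le_measure; rewrite ?inE//.
    by apply/subsetPset; exact: ndF.
  apply: nearW => n /=; have := nF n; rewrite probability_setC//.
  have /fineK <- : mu (F n) \is a fin_num by exact: fin_num_measure.
  rewrite -EFinB lte_fin lee_fin => /negP; rewrite -leNgt; lra.
by rewrite muUF lee_fin; lra.
Qed.

(** The tail is at most [q ^+ N / (1 - q)], so any [N] with
    [q ^+ N < (1 - q) / 2] works. *)
Lemma geometric_tail_le_half (R : realType) (q : R) : 0 < q < 1 ->
  exists2 N, (0 < N)%N & forall L, \sum_(j < L) q ^+ (N + j) <= 2^-1.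
Proof.
move=> /andP[q0 q1]; have q1' : 0 < 1 - q by rewrite subr_gt0.
have : (fun n => q ^+ n) @ \oo --> 0.
  by apply: cvg_expr; rewrite gtr0_norm.
move=> /cvgrPdist_lt/(_ ((1 - q) / 2)) [|N _ HN]; first by rewrite divr_gt0.
exists N.+1 => // L.
have := HN N.+1 (leqnSn N).
rewrite sub0r normrN gtr0_norm ?exprn_gt0// => qN.
under eq_bigr do rewrite exprD.
rewrite -mulr_sumr.
have S : (1 - q) * (\sum_(i < L) q ^+ i) <= 1.
  have := subrXX 1 q L; rewrite expr1n.
  under [X in _ = _ * X -> _]eq_bigr do rewrite expr1n mul1r.
  by move=> <-; rewrite gerBl exprn_ge0// ltW.
have S0 : 0 <= \sum_(i < L) q ^+ i by apply: sumr_ge0 => i _; rewrite exprn_ge0// ltW.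
apply: le_trans (ler_wpM2r S0 (ltW qN)) _.
by rewrite mulrAC ler_pdivrMr// mulVf// pnatr_eq0.
Qed.

Section katok.
Context {R : realType} {X : pmetricType R} (T : X -> X).
Context (mu : probability (borelType X) R).
Context (contT : continuous T).

(** A nonempty set of diameter less than [r] lies in the ball of radius [r]
    around any of its points; empty sets get the default point as centre. *)
Lemma katok_cover_le (delta r q w : R) n (E : set (borelType X)) :
  measurable E -> (delta%:E < mu E)%E -> r <= q ->
  small_cover T r n E w -> (katok_cover T mu delta n q <= w%:E)%E.
Proof.
move=> mE dE rq [I [c [Iw Ec cr]]].
pose z (i : 'I_#|I|) := xget point (c (enum_val i)).
apply: (@le_trans _ _ #|I|%:R%:E); last by rewrite lee_fin.
apply: ereal_inf_lbound; exists #|I| => //; exists z.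
apply: lt_le_trans dE _; apply: le_measure; rewrite ?inE//.
  apply: open_borel; apply: bigcup_open => i _; exact: open_bowen_ball.
move=> x /Ec[i _ cix]; exists (enum_rank i) => //.
apply: lt_le_trans rq; apply: (cr i) => //.
by rewrite /z enum_rankK; apply: xgetI cix.
Qed.

(** With at most [eta * N] visits to the complement of the [A j], Markov's
    inequality makes the set of [small_cover_visits] larger than [delta] in
    measure, and the logarithm of its covering bound is the stated sum. *)
Lemma katok_cover_visits (delta r q eta K C t : R) (M L : nat)
    (A : nat -> set X) (l : nat -> nat) (w : nat -> R) :
  invariant_measure T mu ->
  0 < r <= q -> 0 <= t -> 1 <= K -> 1 <= C -> 0 < eta ->
  (forall j, (j < L)%N -> open (A j)) ->
  (forall j, (j < L)%N -> (0 < l j <= M)%N) ->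
  (forall j, (j < L)%N -> small_cover T r (l j) (A j) (w j)) ->
  \sum_(j < L) w j * expR (- ((l j)%:R * t)) <= 2^-1 ->
  small_cover T r 1 [set: X] K -> small_cover T r M [set: X] C ->
  (mu (~` (\bigcup_(j < L) A j)) < (eta * (1 - delta))%:E)%E ->
  forall N, (0 < N)%N ->
  ((N%:R^-1)%:E * lne (katok_cover T mu delta N q) <=
    (ln C / N%:R + eta * ln (2 * K) + t)%:E)%E.
Proof.
move=> invT /andP[r0 rq] t0 K1 C1 eta0 oA lM lA lw KX CX muG N N0.
have NR : 0 < N%:R :> R by rewrite ltr0n.
set G : set (borelType X) := ~` _ in muG.
pose b := Num.trunc (eta * N%:R).
have mG : measurable G.
  apply: measurableC; apply: open_borel; apply: bigcup_open; exact: oA.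
pose E : set (borelType X) := [set x | (visits T G N x <= b)%N].
have EC : ~` E = [set x | (b < visits T G N x)%N].
  by apply/seteqP; split => x /=; rewrite ltnNge => /negP.
have mE : measurable E.
  rewrite -[X in measurable X]setCK EC; apply: measurableC.
  exact: (measurable_visits contT N b mG).
have dE : (delta%:E < mu E)%E.
  have := visits_markov contT invT N b mG.
  rewrite -EC probability_setC//.
  have /fineK <- : mu E \is a fin_num by exact: fin_num_measure.
  move: muG; have /fineK <- : mu G \is a fin_num by exact: fin_num_measure.
  set g := fine _; set e := fine _.
  rewrite -EFinB -!EFinM !lte_fin lee_fin => gd eg.
  have bN : eta * N%:R < b.+1%:R by exact: truncnS_gt.
  rewrite ltNge; apply/negP => ed.
  have g0 : 0 <= g by exact: fine_ge0.
  have d1 : 0 < 1 - delta.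
    by move: gd; rewrite -(pmulr_rgt0 _ eta0); exact: le_lt_trans.
  have : N%:R * g < b.+1%:R * (1 - e).
    apply: (@lt_le_trans _ _ (eta * N%:R * (1 - delta))).
      by rewrite mulrAC mulrC ltr_pM2r.
    by apply: ler_pM; rewrite ?mulr_ge0 ?(ltW bN) ?lerB ?(ltW d1) ?(ltW eta0).
  by rewrite ltNge eg.
have := katok_cover_le mE dE rq
   (small_cover_visits r0 t0 K1 lM lA lw KX CX N b).
set W := _ * expR _.
move=> kW.
have W0 : 0 < W.
  rewrite /W !mulr_gt0// ?expR_gt0//; first exact: lt_le_trans C1.
  by rewrite exprn_gt0// mulr_gt0//; exact: lt_le_trans K1.
apply: (@le_trans _ _ ((N%:R^-1)%:E * lne W%:E)%E).
  apply: lee_wpmul2l; first by rewrite lee_fin invr_ge0.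
  have kW0 : (0 <= katok_cover T mu delta N q)%E.
    by apply: le_ereal_inf_tmp => _ [k _ <-]; rewrite lee_fin.
  by rewrite lee_lne// in_itv/= leey andbT// ltW.
rewrite lne_EFin// -EFinM lee_fin /W.
have C0 : 0 < C by exact: lt_le_trans C1.
have K0 : 0 < 2 * K by rewrite mulr_gt0// (lt_le_trans _ K1).
rewrite lnM ?posrE ?mulr_gt0 ?exprn_gt0 ?expR_gt0//.
rewrite lnM ?posrE ?exprn_gt0// expRK lnXn// !mulrDr.
rewrite mulKf ?gt_eqF// mulrC lerD2r lerD2l.
have lnK : 0 <= ln (2 * K).
  by rewrite ln_ge0// (le_trans K1)// ler_peMl ?ler1n// (le_trans _ K1).
rewrite -[_ *+ b]mulr_natl mulrA ler_wpM2r// mulrC ler_pdivrMr//.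
by rewrite -[leLHS]/(b%:R) truncn_le mulr_ge0// ltW.
Qed.

End katok.

(** The parameters are chosen in this order: [gamma], a third of the allowed
    error; [n0], where the window of times starts, to make the series of
    [expR (- (n * gamma))] small; [K], from [epsilon] alone; [eta], so small that
    [eta * ln (2 * K) <= gamma]; the length [L] of the window, so large that few
    points are heavy for no time in it; and finally [C]. *)
Lemma katok_entropy_le (R : realType) (X : pmetricType R) (T : X -> X)
    (mu : probability (borelType X) R) (epsilon delta s : R) :
  compact [set: X] -> continuous T -> invariant_measure T mu ->
  0 < epsilon -> delta < 1 -> 0 <= s ->
  {ae mu, forall x, (lower_local_entropy T mu x epsilon < s%:E)%E} ->
  (katok_entropy T mu (6 * epsilon) delta <= s%:E)%E.
Proof.
move=> cptX contT invT eps0 delta1 s0 ae_s; apply/lee_addgt0Pr => e e0.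
pose gamma := e / 3; have gamma0 : 0 < gamma by rewrite divr_gt0.
pose r := 4 * epsilon; have r0 : 0 < r by rewrite mulr_gt0.
have rq : 0 < r <= 6 * epsilon by rewrite r0 ler_wpM2r ?ler_nat// ltW.
pose t := s + gamma; have t0 : 0 <= t by rewrite addr_ge0// ltW.
have [|n0 n0_gt0 geo] := @geometric_tail_le_half R (expR (- gamma)).
  by rewrite expR_gt0 -expR0 ltr_expR oppr_lt0.
pose A j := heavy T mu (n0 + j) epsilon s.
pose w j : R := expR ((n0 + j)%:R * s).
have oA j : open (A j) by exact: open_heavy.
have AX j : small_cover T r (n0 + j) (A j) (w j) by exact: heavy_small_cover.
have [K KX K1] : exists2 K, small_cover T r 1 [set: X] K & 1 <= K.
  have [K KX] := compact_small_cover 1 cptX contT r0.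
  exists (Num.max K 1); last by rewrite le_max lexx orbT.
  by apply: small_coverS KX => //; rewrite le_max lexx.
have lnK : 0 <= ln (2 * K).
  by rewrite ln_ge0// (le_trans K1)// ler_peMl ?ler1n// (le_trans _ K1).
(* The summand 1 only keeps the denominator away from 0. *)
pose eta := gamma / (ln (2 * K) + 1).
have lnK1 : 0 < ln (2 * K) + 1 by rewrite ltr_wpDl.
have eta0 : 0 < eta by rewrite divr_gt0.
have eta_gamma : eta * ln (2 * K) <= gamma.
  by rewrite mulrAC ler_pdivrMr// ler_wpM2l ?lerDl// ltW.
have [L muL] : exists L,
    (mu (~` (\bigcup_(j < L) A j)) < (eta * (1 - delta))%:E)%E.
  apply: (@ae_bigcup_setC_small _ _ _ mu (fun L => \bigcup_(j < L) A j)).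
  - by move=> n; apply: open_borel; exact: bigcup_open.
  - move=> m n mn; apply/subsetPset => x [j /= jm Ajx]; exists j => //=.
    exact: leq_trans mn.
  - apply: (@filterS _ _ (ae_filter_ringOfSetsType mu) _ _ _ ae_s) => x.
    move=> /(lower_local_entropy_heavy contT n0)[n nn hn].
    exists (n - n0).+1 => //; exists (n - n0)%N => //=.
    by rewrite /A subnKC// ltnW.
  - by rewrite mulr_gt0// subr_gt0.
have [C CX C1] : exists2 C, small_cover T r (n0 + L) [set: X] C & 1 <= C.
  have [C CX] := compact_small_cover (n0 + L) cptX contT r0.
  exists (Num.max C 1); last by rewrite le_max lexx orbT.
  by apply: small_coverS CX => //; rewrite le_max lexx.
have sumw : \sum_(j < L) w j * expR (- ((n0 + j)%:R * t)) <= 2^-1.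
  apply: le_trans (geo L); apply: ler_sum => j _.
  by rewrite /w -expRD /t mulrDr opprD addrA subrr add0r -mulrN expRM_natl.
have lM j : (j < L)%N -> (0 < n0 + j <= n0 + L)%N.
  by move=> jL; rewrite addn_gt0 n0_gt0 leq_add2l/= ltnW.
pose N1 := (Num.bound (ln C / gamma)).+1.
apply: (@limn_esup_le _ _ (s + e) N1) => N N1N.
have N_gt0 : (0 < N)%N by exact: leq_trans N1N.
have NR : 0 < N%:R :> R by rewrite ltr0n.
apply: le_trans (katok_cover_visits contT invT rq t0 K1 C1 eta0 (fun j _ => oA j)
   lM (fun j _ => AX j) sumw KX CX muL N_gt0) _.
have lnC : ln C / N%:R <= gamma.
  rewrite ler_pdivrMr// mulrC -ler_pdivrMr//.
  apply: (@le_trans _ _ (Num.bound (ln C / gamma))%:R).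
    by apply/ltW/archi_boundP; rewrite divr_ge0 ?ln_ge0// ltW.
  by rewrite ler_nat ltnW.
rewrite lee_fin /t (_ : e = gamma + gamma + gamma); last by rewrite /gamma; field.
lra.
Qed.

Theorem theorem1 (R : realType) (X : pmetricType R) (T : X -> X)
  (cptX : compact [set: X]) (contT : continuous T)
  (mu : probability (borelType X) R) (erg : ergodic_measure T mu)
  (epsilon delta : R) (epsilon_gt0 : 0 < epsilon)
  (delta_gt0 : 0 < delta) (delta_lt1 : delta < 1) :
  (katok_entropy T mu (6 * epsilon) delta <= lower_brin_katok T mu epsilon)%E.
Proof.
have ae_h := lower_brin_katokP contT epsilon_gt0 erg.
set h := lower_brin_katok _ _ _ in ae_h *.
have mu0 : (0 < mu [set: borelType X])%E by rewrite probability_setT lte01.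
have h0 : (0 <= h)%E.
  rewrite -(ess_inf_ae_cst h mu0 ae_h); apply: ess_inf_gee => //.
  by apply: aeW => x; exact: lower_local_entropy_ge0.
apply: lee_EFin_ub => s hs; apply: katok_entropy_le => //.
- by case: erg.
- by rewrite -lee_fin (le_trans h0)// ltW.
- by apply: (@filterS _ _ (ae_filter_ringOfSetsType mu) _ _ _ ae_h) => x ->.
Qed.
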